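(* Let $N\ge 1$ be a fixed integer, and let $\{x_n\}_{n\in\mathbb{N}}$ be generated by the exact-data SESOP algorithm described in the context, where for each $n\in\mathbb{N}$ the current gradient $g_n=F'(x_n)^*(F(x_n)-y)$ belongs to the search space $U_n=\{u_{n,i}: i\in I_n\}$ (that is, $n\in I_n$), the index sets satisfy $$I_n\subset\{n-N+1,\dots,n\},$$ and $$w_{n,i}:=R_i=F(x_i)-y\quad\text{for each } i\in I_n.$$ Suppose that $x^+\in B_{\rho/2}(x_0)$ is the unique solution of $F(x)=y$ in $B_\rho(x_0)$, and that the optimization parameters $t_{n,i}$ in $x_{n+1}=x_n-\sum_{i\in I_n}t_{n,i}F'(x_i)^*w_{n,i}$ fulfill $$|t_{n,i}|\le t\quad\text{for all } n\in\mathbb{N},\ i\in I_n,$$ for some $t>0$. Then $\{x_n\}_{n\in\mathbb{N}}$ converges strongly to $x^+$.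
   Context: Setting. $X,Y$ are real Hilbert spaces, $F:\mathcal{D}(F)\subset X\to Y$ is a (nonlinear) operator, $y\in Y$ is exact data. $B_r(a)$ denotes the closed ball of radius $r$ about $a$. $F$ is continuous and Fr\'echet differentiable in a ball $B_\rho(x_0)\subset\mathcal{D}(F)$, $\rho>0$, with continuous Fr\'echet derivative $F'$; $F'(x)^*:Y\to X$ denotes the Hilbert space adjoint of $F'(x)$. There is a solution $x^+\in B_{\rho/2}(x_0)$ of $F(x)=y$. The tangential cone condition holds: there is a constant $0\le c_{\mathrm{tc}}<1$ with $\|F(x)-F(\tilde x)-F'(x)(x-\tilde x)\|\le c_{\mathrm{tc}}\|F(x)-F(\tilde x)\|$ for all $x,\tilde x\in B_\rho(x_0)$. There is $c_F>0$ with $\|F'(x)\|<c_F$ for all $x\in B_\rho(x_0)$. $F$ is weakly sequentially closed: if $x_n\rightharpoonup x$ and $F(x_n)\to y'$, then $x\in\mathcal{D}(F)$ and $F(x)=y'$. For $u\in X$, $\alpha\in\mathbb{R}$, $\xi\ge 0$ the stripe is $H(u,\alpha,\xi):=\{x\in X: |\langle u,x\rangle-\alpha|\le\xi\}$. Exact-data SESOP algorithm. Start with $x_0$. In step $n\in\mathbb{N}$ (starting with $n=0$) choose a finite index set $I_n\subset\{0,\dots,n\}$ and elements $w_{n,i}\in Y$, $i\in I_n$, and define the stripes $H_{n,i}:=H(u_{n,i},\alpha_{n,i},\xi_{n,i})$ with $u_{n,i}:=F'(x_i)^*w_{n,i}$, $\alpha_{n,i}:=\langle F'(x_i)^*w_{n,i},x_i\rangle-\langle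 w_{n,i},F(x_i)-y\rangle$, $\xi_{n,i}:=c_{\mathrm{tc}}\|w_{n,i}\|\,\|R_i\|$, $R_i:=F(x_i)-y$. The new iterate is the metric projection $x_{n+1}=P_{\bigcap_{i\in I_n}H_{n,i}}(x_n)=\mathrm{argmin}_{x\in\bigcap_{i\in I_n}H_{n,i}}\|x_n-x\|$, written as $x_{n+1}=x_n-\sum_{i\in I_n}t_{n,i}F'(x_i)^*w_{n,i}$ with real coefficients $t_{n,i}$ (the optimization parameters). *)

(* Defs.v *)
From HB Require Import structures.
From mathcomp Require Import all_boot all_order all_algebra.
From mathcomp Require Import all_classical all_reals all_analysis.
Import Order.TTheory GRing.Theory Num.Theory.
Import numFieldNormedType.Exports.

Set Implicit Arguments.
Unset Strict Implicit.
Unset Printing Implicit Defensive.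

Local Open Scope classical_set_scope.
Local Open Scope ring_scope.

(* Real Hilbert spaces: complete normed modules over R whose norm is induced by
   a symmetric positive definite bilinear form. *)
HB.mixin Record NormedModule_isHilbert (R : realType) X
    of CompleteNormedModule R X := {
  inner : {dot X for idfun} ;
  inner_norm : forall x : X, inner x x = `|x| ^+ 2
}.

#[short(type="hilbertType")]
HB.structure Definition Hilbert (R : realType) :=
  {X of CompleteNormedModule R X & NormedModule_isHilbert R X}.

Section Definitions.
Context {R : realType} {X Y : hilbertType R}.

Definition opnorm (A : X -> Y) : R :=
  sup [set `|A v| | v in [set v | `|v| <= 1]].

(* For continuous A this is the unique u with <u, v> = <w, A v> for all v,
   which exists by the Riesz representation theorem. *)
Definition adjoint (A : {linear X -> Y}) (w : Y) : X :=
  xget 0 [set u : X | forall v : X, inner u v = inner w (A v)].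

Definition weakly_converges (x : nat -> X) (l : X) : Prop :=
  forall u : X, inner u (x n) @[n --> \oo] --> (inner u l : R).

(* Partially defined operators are represented by a total function F together
   with a domain D; values of F outside D are never used. *)
Definition weakly_sequentially_closed (D : set X) (F : X -> Y) : Prop :=
  forall (x : nat -> X) (l : X) (y : Y), (forall n, D (x n)) ->
    weakly_converges x l -> F (x n) @[n --> \oo] --> y -> D l /\ F l = y.

(* A is the Frechet derivative at x of F : D -> Y.  The increment z - x ranges
   over points z of D, so at interior points of D this is the usual notion. *)
Definition is_frechet_derivative (D : set X) (F : X -> Y) (x : X)
    (A : {linear X -> Y}) : Prop :=
  continuous A /\
  forall z, F z = F x + A (z - x) +o_(z \near within D (nbhs x)) (z - x).

Definition continuous_derivative_on (B : set X) (F' : X -> {linear X -> Y}) :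
    Prop :=
  forall x, B x -> opnorm (F' z \- F' x) @[z --> within B (nbhs x)] --> (0 : R).

Definition tangential_cone_condition (B : set X) (F : X -> Y)
    (F' : X -> {linear X -> Y}) (ctc : R) : Prop :=
  forall x x' : X, B x -> B x' ->
    `|F x - F x' - F' x (x - x')| <= ctc * `|F x - F x'|.

Definition stripe (u : X) (alpha xi : R) : set X :=
  [set x : X | `|inner u x - alpha| <= xi].

Definition is_metric_projection (S : set X) (x p : X) : Prop :=
  S p /\ forall z, S z -> `|x - p| <= `|x - z|.

(* In terms of the residual r = F a - y at the iterate a, this is
   H(u, <u, a> - <w, r>, ctc * |w| * |r|) with u = F'(a)^* w; under the tangential
   cone condition it contains every solution of F x = y in the ball. *)
Definition sesop_stripe (F : X -> Y) (F' : X -> {linear X -> Y}) (y : Y)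
    (ctc : R) (a : X) (w : Y) : set X :=
  let u := adjoint (F' a) w in
  stripe u (inner u a - inner w (F a - y)) (ctc * `|w| * `|F a - y|).

Record is_sesop_sequence (F : X -> Y) (F' : X -> {linear X -> Y}) (y : Y)
    (ctc : R) (x0 : X) (I : forall n : nat, {set 'I_n.+1})
    (w : nat -> nat -> Y) (t : nat -> nat -> R) (x : nat -> X) : Prop := {
  sesop_start : x 0%N = x0 ;
  sesop_projection : forall n : nat,
    is_metric_projection
      (\bigcap_(i in [set` I n]) sesop_stripe F F' y ctc (x i) (w n i))
      (x n) (x n.+1) ;
  sesop_expansion : forall n : nat,
    x n.+1 = x n - \sum_(i in I n) t n i *: adjoint (F' (x i)) (w n i)
}.

End Definitions.

(* Main.v *)
Require Import Defs.
From HB Require Import structures.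
From mathcomp Require Import all_boot all_order all_algebra.
From mathcomp Require Import all_classical all_reals all_analysis.
From mathcomp Require Import ring lra zify.
Import Order.TTheory GRing.Theory Num.Theory.
Import numFieldNormedType.Exports.
Local Open Scope classical_set_scope.
Local Open Scope ring_scope.

(** The cone condition puts xplus in every stripe, so metric projection makes
    |x_n - xplus| decrease, with |x_{n+1} - x_n|^2 bounded by the decrease of its
    square.  Since x_{n+1} lies in the stripe of the current gradient, the residual
    |R_n| is at most a constant times |x_{n+1} - x_n|; hence sum |R_n|^2 < oo.
    The cone condition also gives
    |F'(x_i) (x_l - xplus)| <= (1 + ctc) (|R_l| + 2 |R_i|), so with w_{n,i} = R_i and
    bounded t_{n,i} the pairing <x_{n+1} - x_n, x_l - xplus> is controlled, whenever
    |R_l| <= |R_n|, by a summable combination of squared residuals.  This makes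
    (x_n) Cauchy, and its limit solves F x = y. *)

(** * Inner product identities and Cauchy-Schwarz *)

Section InnerProduct.
Context {R : realType} {X : hilbertType R}.
Implicit Types (u v w : X) (a : R).

Lemma innerC u v : inner u v = inner v u.
Proof. by rewrite hermC expr0 mul1r. Qed.

Lemma normD_sq u v : `|u + v| ^+ 2 = `|u| ^+ 2 + 2 * inner u v + `|v| ^+ 2.
Proof.
by rewrite -!inner_norm linearDl !linearDr /= (innerC v u); ring.
Qed.

Lemma normB_sq u v : `|u - v| ^+ 2 = `|u| ^+ 2 - 2 * inner u v + `|v| ^+ 2.
Proof. by rewrite normD_sq linearNr normrN mulrN. Qed.

Lemma innerZl a u v : inner (a *: u) v = a * inner u v.
Proof. by rewrite linearZl_LR. Qed.

Lemma innerZr a u v : inner u (a *: v) = a * inner u v.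
Proof. by rewrite linearZr_LR. Qed.

Lemma normZ_sq a u : `|a *: u| ^+ 2 = a ^+ 2 * `|u| ^+ 2.
Proof. by rewrite normrZ exprMn real_normK ?num_real. Qed.

Lemma inner_le u v : inner u v <= `|u| * `|v|.
Proof.
have [->|u0] := eqVneq u 0; first by rewrite linear0l normr0 mul0r.
have [->|v0] := eqVneq v 0; first by rewrite linear0r normr0 mulr0.
(* Expanding this square gives [2 |u| |v| (|u| |v| - <u, v>) >= 0]. *)
have := exprn_ge0 2 (normr_ge0 (`|v| *: u - `|u| *: v)).
rewrite normB_sq !normZ_sq innerZl innerZr => h.
have uv0 : 0 < `|u| * `|v| by rewrite mulr_gt0 ?normr_gt0.
by rewrite -(ler_pM2l uv0); nra.
Qed.

Lemma innerDr u v w : inner u (v + w) = inner u v + inner u w.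
Proof. by rewrite linearDr. Qed.

Lemma innerNr u v : inner u (- v) = - inner u v.
Proof. by rewrite linearNr. Qed.

Lemma innerBl u v w : inner (u - v) w = inner u w - inner v w.
Proof. by rewrite linearBl. Qed.

Lemma innerBr u v w : inner u (v - w) = inner u v - inner u w.
Proof. by rewrite linearBr. Qed.

Lemma norm_inner_le u v : `|inner u v| <= `|u| * `|v|.
Proof.
by rewrite ler_norml inner_le andbT lerNl -linearNr (le_trans (inner_le _ _))// normrN.
Qed.

Lemma inner_continuous u : continuous (fun v => inner u v : R^o).
Proof.
apply/(linear_bounded_continuous (inner u : {linear X -> R^o})).
apply/linear_boundedP; near=> r => v.
by rewrite (le_trans (norm_inner_le _ _))// ler_wpM2r.
Unshelve. all: by end_near.
Qed.

Lemma cvg_of_sq_dist (x : nat -> X) (e : nat -> R) :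
  (forall j k, (j <= k)%N -> `|x j - x k| ^+ 2 <= e j) ->
  e n @[n --> \oo] --> 0 -> cvgn x.
Proof.
move=> xe e0; apply/cauchy_cvgP/cauchy_exP => d d0.
have d2 : 0 < d ^+ 2 by rewrite exprn_gt0.
have [j _ ej] : \forall n \near \oo, e n < d ^+ 2 by apply: cvgr_lt d2.
exists (x j); exists j => // k /= jk.
rewrite -ball_normE /= -(@ltr_pXn2r _ 2%N) ?nnegrE ?normr_ge0 ?ltW//.
by rewrite (le_lt_trans (xe _ _ jk))// ej/=.
Qed.

End InnerProduct.

(** * Riesz representation *)

Section Riesz.
Context {R : realType} {X : hilbertType R}.

(* The representing vector minimizes the quadratic functional |v|^2 - 2 phi v; by
   the parallelogram law minimizing sequences are Cauchy. *)
Lemma riesz_representation (phi : {linear X -> R^o}) :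
  continuous phi -> exists u, forall v, inner u v = phi v.
Proof.
move=> phic.
pose p v : R := phi v.
have pD u v : p (u + v) = p u + p v by rewrite /p linearD.
have pZ a v : p (a *: v) = a * p v by rewrite /p linearZ.
pose J v : R := `|v| ^+ 2 - 2 * p v.
have [M J_lb] : exists M : R, forall v, M <= J v.
  have /linear_boundedP bp := (linear_bounded_continuous phi).2 phic.
  have [M hM] := filter_ex bp.
  (* [J v >= |v|^2 - 2 M |v| = (|v| - M)^2 - M^2]. *)
  exists (- M ^+ 2) => v; rewrite /J.
  have := hM v; rewrite ler_norml => /andP[_ h].
  have : 0 <= (`|v| - M) ^+ 2 by exact: sqr_ge0.
  have {}h : p v <= M * `|v| := h.
  nra.
have infJ : has_inf (range J).
  by split; [exists (J 0), 0|exists M => _ [v _ <-]].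
pose m := inf (range J).
have Jm v : m <= J v by apply: ge_inf; [case: infJ|exists v].
have [x xJ] : exists x : nat -> X, forall n, J (x n) < m + n.+1%:R^-1.
  suff h n : exists v, J v < m + n.+1%:R^-1.
    by exists (fun n => sval (cid (h n))) => n; case: cid.
  have n0 : 0 < n.+1%:R^-1 :> R by rewrite invr_gt0.
  by have [_ [v _ <-] ?] := inf_adherent n0 infJ; exists v.
(* The square equals [2 J (x j) + 2 J (x k) - 4 J ((x j + x k) / 2)], and [J] at the midpoint is at
   least [m]. *)
have xcauchy j k : (j <= k)%N -> `|x j - x k| ^+ 2 <= 4 * j.+1%:R^-1.
  move=> jk.
  have := Jm (2^-1 *: (x j + x k)); have := xJ j; have := xJ k.
  have : k.+1%:R^-1 <= j.+1%:R^-1 :> R by rewrite lef_pV2 ?posrE// ler_nat.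
  rewrite /J normZ_sq pZ pD normD_sq normB_sq.
  move: j.+1%:R^-1 k.+1%:R^-1 => a b; lra.
have e0 : (4 * n.+1%:R^-1 : R) @[n --> \oo] --> 0.
  by rewrite -[X in _ --> X](mulr0 4); apply: cvgMr; exact: cvg_harmonic.
have /cvg_ex[u xu] := cvg_of_sq_dist _ _ xcauchy e0.
have Ju v : J u <= J v.
  apply: le_trans (Jm v).
  have JxJu : J (x n) @[n --> \oo] --> J u.
    apply: cvgB; first by apply: cvgM; apply: cvg_norm.
    by apply: cvgMr; apply: continuous_cvg => //; exact: phic.
  have m0 : (m + n.+1%:R^-1) @[n --> \oo] --> m.
    by rewrite -[X in _ --> X]addr0; apply: cvgD; [exact: cvg_cst|exact: cvg_harmonic].
  by apply: ler_cvg_to JxJu m0 _; near=> n; exact/ltW.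
exists u => v; set b := `|v| ^+ 2; set c := inner u v - p v.
have b0 : 0 <= b by exact: exprn_ge0.
(* A step [s] along [v] changes [J] by [2 s c + s^2 b]. Dividing by [b + 1] instead of [b] also
   covers [v = 0]; the change is then a negative multiple of [c^2], which forces [c = 0]. *)
have := Ju (u + (- c / (b + 1)) *: v).
rewrite /J normD_sq innerZr normZ_sq pD pZ -/b => h.
have {}h : 0 <= 2 * (- c / (b + 1)) * c + (- c / (b + 1)) ^+ 2 * b.
  by rewrite {2}/c; lra.
have b1 : b + 1 != 0 by rewrite gt_eqF// ltr_wpDl.
have h2 : 0 <= - (c ^+ 2 * (b + 2)).
  have -> : - (c ^+ 2 * (b + 2)) =
      (2 * (- c / (b + 1)) * c + (- c / (b + 1)) ^+ 2 * b) * (b + 1) ^+ 2.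
    by field.
  by rewrite mulr_ge0// exprn_ge0// addr_ge0.
have c0 : c ^+ 2 = 0.
  by apply/eqP; rewrite eq_le sqr_ge0 andbT; have := sqr_ge0 c; nra.
by apply/eqP; rewrite -subr_eq0 -sqrf_eq0 -/c c0.
Unshelve. all: by end_near.
Qed.

End Riesz.

(** * Adjoint and operator norm *)

Section BoundedOperators.
Context {R : realType} {X Y : hilbertType R}.
Implicit Types (A : {linear X -> Y}).

(** Riesz representation makes the set in [adjoint] nonempty, so [xget] does not fall back on its
    default 0. *)
Lemma adjointE A w v : continuous A -> inner (adjoint A w) v = inner w (A v).
Proof.
move=> Ac; rewrite /adjoint.
case: xgetP => [u _ -> //|].
have [u hu] := riesz_representation (inner w \o A : {linear X -> R^o})
  (fun v => continuous_comp (Ac v) (inner_continuous w (A v))).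
by move=> /(_ u); case.
Qed.

Lemma opnorm_le A v : continuous A -> `|A v| <= opnorm A * `|v|.
Proof.
move=> /linear_bounded_continuous/linear_boundedP/filter_ex[M hM].
have [->|v0] := eqVneq v 0; first by rewrite linear0 !normr0 mulr0.
have nv : 0 < `|v| by rewrite normr_gt0.
rewrite -ler_pdivrMr//.
have -> : `|A v| / `|v| = `|A (`|v|^-1 *: v)|.
  by rewrite linearZ normrZ ger0_norm ?invr_ge0// mulrC.
apply: ub_le_sup.
  exists `|M| => _ [u /= u1 <-]; apply: (le_trans (hM u)).
  by rewrite (le_trans (ler_wpM2r _ (ler_norm M)))// ler_piMr.
exists (`|v|^-1 *: v) => //=.
by rewrite normrZ ger0_norm ?invr_ge0// mulVf// gt_eqF.
Qed.

End BoundedOperators.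

(** * Metric projection onto convex sets *)

Section MetricProjection.
Context {R : realType} {X : hilbertType R}.

Definition segment_closed (S : set X) : Prop :=
  forall a b (s : R), S a -> S b -> 0 <= s -> s <= 1 -> S (a + s *: (b - a)).

Lemma segment_closed_stripe u alpha xi : segment_closed (stripe u alpha xi).
Proof.
move=> a b s; rewrite /stripe /= => ha hb s0 s1.
rewrite innerDr innerZr innerBr.
have -> : inner u a + s * (inner u b - inner u a) - alpha =
  (1 - s) * (inner u a - alpha) + s * (inner u b - alpha) by ring.
have s1' : 0 <= 1 - s by rewrite subr_ge0.
rewrite (le_trans (ler_normD _ _))// !normrM (ger0_norm s0) (ger0_norm s1').
have := ler_wpM2l s0 hb; have := ler_wpM2l s1' ha; lra.
Qed.

(** If [<p - z, p - x>] were positive, some point of the segment from [p] to [z] would be closer to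
    [x] than [p]. *)
Lemma projection_sq_dist (S : set X) x p z : segment_closed S ->
  is_metric_projection S x p -> S z ->
  `|p - z| ^+ 2 + `|p - x| ^+ 2 <= `|x - z| ^+ 2.
Proof.
move=> Sseg [Sp pmin] Sz.
have -> : x - z = (p - z) - (p - x) by rewrite opprB [RHS]addrC addrA subrK.
rewrite [leRHS]normB_sq.
set c := inner (p - z) (p - x); set b := `|p - z| ^+ 2.
suff c0 : c <= 0 by nra.
rewrite leNgt; apply/negP => c0.
have b0 : 0 <= b by exact: exprn_ge0.
have bc0 : 0 < b + c by rewrite ltr_wpDl.
(* The optimal step [c / b] may exceed 1 or have a zero denominator; adding [c] avoids both.
   Minimality of [p] would give [s b >= 2 c], whereas [s b <= c]. *)
pose s := c / (b + c).
have s0 : 0 <= s by rewrite divr_ge0// ltW.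
have s1 : s <= 1 by rewrite ler_pdivrMr// mul1r lerDr.
have := pmin _ (Sseg _ _ _ Sp Sz s0 s1).
rewrite -(@ler_pXn2r _ 2%N) ?nnegrE ?normr_ge0//.
have -> : x - (p + s *: (z - p)) = s *: (p - z) - (p - x).
  by rewrite -[z - p]opprB scalerN opprD opprK addrA addrC opprB.
rewrite [`|x - p|]distrC (normB_sq (s *: _)) normZ_sq innerZl -/b -/c => h.
have sE : s * (b + c) = c by rewrite mulfVK ?gt_eqF.
have s_gt0 : 0 < s by rewrite divr_gt0.
have {h} : 0 <= s * (s * b - 2 * c) by nra.
by rewrite pmulr_rge0//; nra.
Qed.

End MetricProjection.

(** * Sums over sliding windows *)

Section Summation.
Context {R : realType}.

Lemma card_window_le (M a N : nat) (P : pred 'I_M) :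
  (forall i, P i -> (a <= i < a + N)%N) -> (#|P| <= N)%N.
Proof.
move=> Pa; rewrite cardE -(size_map val) -[leqRHS](size_iota a).
apply: uniq_leq_size; first by rewrite map_inj_uniq ?enum_uniq//; exact: val_inj.
by move=> m /mapP[i]; rewrite mem_enum mem_iota => /Pa ? ->.
Qed.

(** After exchanging the sums, [f i] is counted only for [i <= n < i + N], hence at most [N]
    times. *)
Lemma window_sum_le (f : nat -> R) (N M : nat) : (forall i, 0 <= f i) ->
  \sum_(n < M) \sum_(i < n.+1 | (n < i + N)%N) f i <= N%:R * \sum_(i < M) f i.
Proof.
move=> f0.
have -> : \sum_(n < M) \sum_(i < n.+1 | (n < i + N)%N) f i =
    \sum_(n < M) \sum_(i < M | (i <= n < i + N)%N) f i.
  apply: eq_bigr => n _.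
  rewrite (big_ord_widen_cond _ (fun i => n < i + N)%N f (ltn_ord n)).
  by apply: eq_bigl => i; rewrite ltnS andbC.
rewrite (exchange_big_dep xpredT)//= mulr_sumr; apply: ler_sum => i _.
rewrite sumr_const -[leLHS]mulr_natl ler_wpM2r// ler_nat.
exact: (@card_window_le _ i).
Qed.

Lemma segment_argmin (r : nat -> R) (j k : nat) : (j <= k)%N ->
  exists2 l, (j <= l <= k)%N & forall n, (j <= n <= k)%N -> r l <= r n.
Proof.
move=> jk.
case: (@arg_minP _ _ _ (@ord0 (k - j)) xpredT (fun i => r (j + i)%N)) => // i _ imin.
exists (j + i)%N.
  by rewrite leq_addr/= -leq_subRL// -ltnS ltn_ord.
move=> n /andP[jn nk].
have nj : (n - j < (k - j).+1)%N by rewrite ltnS leq_sub2r.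
by have := imin (Ordinal nj) isT; rewrite /= subnKC.
Qed.

End Summation.

(** * Strong convergence of Fejer monotone sequences *)

Section Fejer.
Context {R : realType} {X : hilbertType R}.

(* Hanke-Neubauer-Scherzer: to compare x_j and x_k, pass through an index l
   between j and k at which r is minimal, and use
   |x_j - x_l|^2 = |x_j - z|^2 - |x_l - z|^2 + 2 <x_l - x_j, x_l - z>. *)
Lemma cvg_of_fejer (x : nat -> X) (z : X) (r q : nat -> R) (B : R) :
  (forall n, `|x n.+1 - z| <= `|x n - z|) ->
  (forall n l, r l <= r n -> `|inner (x n.+1 - x n) (x l - z)| <= q n) ->
  (forall n, \sum_(i < n) q i <= B) ->
  cvgn x.
Proof.
move=> fej hq qB.
pose a n := `|x n - z| ^+ 2.
pose G n := \sum_(0 <= i < n) q i.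
have aS n : a n.+1 <= a n by rewrite /a ler_pXn2r ?nnegrE.
have a_mono j k : (j <= k)%N -> a k <= a j.
  by apply/nonincreasing_seqP: j k.
have dist j l : `|x j - x l| ^+ 2 = a j - a l + 2 * inner (x l - x j) (x l - z).
  have -> : x j - x l = (x j - z) - (x l - z) by rewrite opprB addrA subrK.
  have -> : x l - x j = (x l - z) - (x j - z) by rewrite opprB addrA subrK.
  rewrite /a; move: (x j - z) (x l - z) => u v.
  by rewrite normB_sq innerBl inner_norm; ring.
have tel j k l : (j <= k)%N -> (forall n, (j <= n < k)%N -> r l <= r n) ->
    `|inner (x k - x j) (x l - z)| <= G k - G j.
  move=> jk rl.
  rewrite -(telescope_sumr x jk) linear_sumlz /=.
  rewrite /G (@big_cat_nat _ _ _ j 0 k)//= [X in _ <= X - _]addrC addrK.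
  rewrite (le_trans (ler_norm_sum _ _ _))//.
  by apply: ler_sum_nat => n n1; exact/hq/rl.
(* Combining [|x j - x k|^2 <= 2 |x j - x l|^2 + 2 |x k - x l|^2] with [a k <= a l] eliminates [l]
   and leaves a difference of values of [h]. So [h] is nonincreasing, and it is bounded below
   because [G] is bounded above. *)
pose h n := 2 * a n - 4 * G n.
have hdist j k : (j <= k)%N -> `|x j - x k| ^+ 2 <= h j - h k.
  move=> jk; have [l /andP[jl lk] lmin] := segment_argmin r _ _ jk.
  have h1 : `|x j - x l| ^+ 2 <= a j - a l + 2 * (G l - G j).
    rewrite dist lerD2l ler_pM2l// (le_trans (ler_norm _))// tel// => n /andP[jn nl].
    by rewrite lmin// jn (leq_trans (ltnW nl)).
  have h2 : `|x k - x l| ^+ 2 <= a k - a l + 2 * (G k - G l).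
    rewrite dist lerD2l ler_pM2l// -opprB linearNl (le_trans (ler_norm _))// normrN.
    by rewrite tel// => n /andP[ln nk]; rewrite lmin// (leq_trans jl ln) ltnW.
  have -> : x j - x k = (x j - x l) - (x k - x l) by rewrite opprB addrA subrK.
  have := exprn_ge0 2 (normr_ge0 ((x j - x l) + (x k - x l))).
  have := a_mono _ _ lk; rewrite /h; move: (x j - x l) (x k - x l) h1 h2 => u v.
  by rewrite (normD_sq u v) (normB_sq u v); lra.
have h_mono : {homo h : n m / (n <= m)%N >-> m <= n}.
  by move=> j k /hdist d; rewrite -subr_ge0 (le_trans _ d)// exprn_ge0.
have h_lb n : - (4 * B) <= h n.
  have : 0 <= a n by exact: exprn_ge0.
  by have := qB n; rewrite -(big_mkord xpredT q) /h -/(G n); lra.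
have hc : cvgn h.
  apply: nonincreasing_is_cvgn => //.
  by exists (- (4 * B)) => _ [n _ <-].
apply: (@cvg_of_sq_dist _ _ x (fun n => h n - limn h)).
  move=> j k jk; rewrite (le_trans (hdist _ _ jk))// lerD2l lerN2.
  exact: nonincreasing_cvgn_ge.
exact/subr_cvg0.
Qed.

End Fejer.

(** * Consequences of the tangential cone condition *)

Section Sesop.
Context {R : realType} {X Y : hilbertType R}.
Context (F : X -> Y) (F' : X -> {linear X -> Y}) (B : set X) (c : R).
Context (tcc : tangential_cone_condition B F F' c).

(** The deviation of [z] from the centre of the stripe is [<w, F a - F z + F' a (z - a)>], a pairing
    with the linearization error. *)
Lemma solution_in_sesop_stripe (a z : X) (w : Y) :
  continuous (F' a) -> B a -> B z ->
  sesop_stripe F F' (F z) c a w z.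
Proof.
move=> Fc Ba Bz; rewrite /sesop_stripe /stripe /=.
rewrite opprB addrA addrAC -innerBr adjointE// -innerDr.
rewrite (le_trans (norm_inner_le _ _))// -mulrA mulrCA ler_wpM2l//.
rewrite (le_trans _ (tcc _ _ Ba Bz))// le_eqVlt; apply/orP; left; apply/eqP.
by congr `|_|; rewrite -[z - a]opprB linearN addrC.
Qed.

(** For [w = F a - y] the upper stripe inequality reads [<w, F' a (b - a)> + |w|^2 <= c |w|^2].
    Cauchy-Schwarz and division by [|w|] finish. *)
Lemma residual_le_step (a b : X) (y : Y) (M : R) :
  continuous (F' a) -> opnorm (F' a) <= M ->
  sesop_stripe F F' y c a (F a - y) b ->
  (1 - c) * `|F a - y| <= M * `|b - a|.
Proof.
move=> Fc FM; rewrite /sesop_stripe /stripe /= => hb.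
have MA : `|F' a (b - a)| <= M * `|b - a|.
  by rewrite (le_trans (opnorm_le _ _ Fc))// ler_wpM2r.
have := inner_le (F a - y) (- F' a (b - a)).
rewrite innerNr normrN -adjointE// innerBr => h.
move: hb; rewrite ler_norml inner_norm => /andP[_ hb].
have [r0|r0] := eqVneq `|F a - y| 0.
  by rewrite r0 mulr0 (le_trans _ MA).
have {}r0 : 0 < `|F a - y| by rewrite lt0r r0 normr_ge0.
by rewrite -(ler_pM2l r0); have := ler_wpM2l (ltW r0) MA; lra.
Qed.

(** The cone condition controls [F' a] only on differences starting at [a], so [b - z] is split as
    [(a - z) - (a - b)]. *)
Lemma deriv_sub_solution_le (a b z : X) : B a -> B b -> B z -> 0 <= c ->
  `|F' a (b - z)| <= (1 + c) * (`|F b - F z| + 2 * `|F a - F z|).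
Proof.
move=> Ba Bb Bz c0.
have lin u : B u -> `|F' a (a - u)| <= (1 + c) * `|F a - F u|.
  move=> Bu; have := tcc _ _ Ba Bu.
  have := ler_normB (F a - F u) (F a - F u - F' a (a - u)).
  by rewrite opprB addrCA subrr addr0; lra.
have -> : b - z = (a - z) - (a - b) by rewrite opprB [RHS]addrC addrA subrK.
rewrite linearB /= (le_trans (ler_normB _ _))//.
have c1 : 0 <= 1 + c by rewrite addr_ge0.
have := ler_normB (F a - F z) (F b - F z); rewrite opprB addrA subrK.
move=> /(ler_wpM2l c1); have := lin _ Bb; have := lin _ Bz; lra.
Qed.

End Sesop.

(** * Convergence of the iterates *)

Theorem theorem4p3 (R : realType) (X Y : hilbertType R)
  (D : set X) (F : X -> Y) (F' : X -> {linear X -> Y})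
  (x0 xplus : X) (y : Y) (rho ctc cF : R)
  (rho_gt0 : 0 < rho)
  (ball_sub_D : closed_ball x0 rho `<=` D)
  (F_cont : {within closed_ball x0 rho, continuous F})
  (F_deriv : forall x, closed_ball x0 rho x -> is_frechet_derivative D F x (F' x))
  (F'_cont : continuous_derivative_on (closed_ball x0 rho) F')
  (ctc_ge0 : 0 <= ctc) (ctc_lt1 : ctc < 1)
  (F_tcc : tangential_cone_condition (closed_ball x0 rho) F F' ctc)
  (cF_gt0 : 0 < cF)
  (F'_bounded : forall x, closed_ball x0 rho x -> opnorm (F' x) < cF)
  (F_wsc : weakly_sequentially_closed D F)
  (xplus_ball : closed_ball x0 (rho / 2) xplus)
  (xplus_sol : F xplus = y)
  (xplus_uniq : forall x, closed_ball x0 rho x -> F x = y -> x = xplus)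
  (N : nat) (N_ge1 : (1 <= N)%N)
  (I : forall n : nat, {set 'I_n.+1})
  (w : nat -> nat -> Y) (t : nat -> nat -> R) (x : nat -> X)
  (x_sesop : is_sesop_sequence F F' y ctc x0 I w t x)
  (I_current : forall n : nat, ord_max \in I n)
  (I_window : forall (n : nat) (i : 'I_n.+1), i \in I n -> (n < i + N)%N)
  (w_residual : forall (n : nat) (i : 'I_n.+1), i \in I n -> w n i = F (x i) - y)
  (tmax : R) (tmax_gt0 : 0 < tmax)
  (t_bounded : forall (n : nat) (i : 'I_n.+1), i \in I n -> `|t n i| <= tmax) :
  x n @[n --> \oo] --> xplus.
Proof.
have Bx0 v : `|v - xplus| <= rho / 2 -> closed_ball x0 rho v.
  move: xplus_ball; rewrite !closed_ballE ?divr_gt0// /closed_ball_ /= => h1 h2.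
  rewrite (splitr rho) -(subrKA xplus).
  by rewrite (le_trans (ler_normD _ _))// lerD// distrC.
have Bxplus : closed_ball x0 rho xplus.
  by apply: Bx0; rewrite subrr normr0 ltW// divr_gt0.
have F'c v : closed_ball x0 rho v -> continuous (F' v) by move=> /F_deriv[].
(* All iterates up to [n] must lie in the ball, since the stripes of step [n] may be built at any of
   them; [near_xplus] discharges this by induction. *)
have fejer n : (forall i, (i <= n)%N -> closed_ball x0 rho (x i)) ->
    `|x n.+1 - xplus| ^+ 2 + `|x n.+1 - x n| ^+ 2 <= `|x n - xplus| ^+ 2.
  move=> Bx; apply: projection_sq_dist (sesop_projection x_sesop n) _.
    move=> a b s Sa Sb s0 s1 i Ii.
    by apply: segment_closed_stripe => //; [exact: Sa|exact: Sb].
  move=> i _; rewrite -xplus_sol.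
  have Bi : closed_ball x0 rho (x i) by apply: Bx; rewrite -ltnS.
  by apply: solution_in_sesop_stripe F_tcc _ _ _ _ _ _ => //; exact: F'c.
have fejer1 n : (forall i, (i <= n)%N -> closed_ball x0 rho (x i)) ->
    `|x n.+1 - xplus| <= `|x n - xplus|.
  move=> /fejer h; rewrite -(@ler_pXn2r _ 2%N) ?nnegrE// (le_trans _ h)//.
  by rewrite lerDl exprn_ge0.
have near_xplus n : forall i, (i <= n)%N -> `|x i - xplus| <= rho / 2.
  elim: n => [|n IH] i.
    rewrite leqn0 => /eqP ->; rewrite (sesop_start x_sesop).
    by move: xplus_ball; rewrite closed_ballE ?divr_gt0.
  rewrite leq_eqVlt => /predU1P[->|]; last by rewrite ltnS; exact: IH.
  by apply: le_trans (IH n (leqnn n)); apply: fejer1 => j /IH; exact: Bx0.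
have Bx n : closed_ball x0 rho (x n) by apply: Bx0; apply: near_xplus (leqnn n).
pose r n := `|F (x n) - y|.
have c1 : 0 < 1 - ctc by rewrite subr_gt0.
have r_step n : r n <= cF / (1 - ctc) * `|x n.+1 - x n|.
  rewrite mulrAC ler_pdivlMr// mulrC.
  apply: residual_le_step; [exact: F'c|exact/ltW/F'_bounded|].
  rewrite -(w_residual n ord_max)//.
  by have [Sn _] := sesop_projection x_sesop n; exact: (Sn ord_max (I_current n)).
pose K := (cF / (1 - ctc)) ^+ 2.
have r2_step n : r n ^+ 2 <= K * (`|x n - xplus| ^+ 2 - `|x n.+1 - xplus| ^+ 2).
  apply: (@le_trans _ _ (K * `|x n.+1 - x n| ^+ 2)).
    rewrite -exprMn ler_pXn2r ?nnegrE ?normr_ge0//.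
    by rewrite mulr_ge0// divr_ge0// ltW.
  by rewrite ler_wpM2l ?sqr_ge0// lerBrDl; apply: fejer.
have r2_sum n : \sum_(i < n) r i ^+ 2 <= K * `|x 0%N - xplus| ^+ 2.
  apply: (@le_trans _ _ (K * (`|x 0%N - xplus| ^+ 2 - `|x n - xplus| ^+ 2))).
    elim: n => [|n IH]; first by rewrite big_ord0 subrr mulr0.
    by rewrite big_ord_recr /=; have := r2_step n; lra.
  by rewrite ler_wpM2l ?sqr_ge0// gerBl exprn_ge0.
pose S n := \sum_(i < n.+1 | (n < i + N)%N) r i ^+ 2.
have T0 : 0 <= tmax * (1 + ctc) by rewrite mulr_ge0 ?addr_ge0// ltW.
(* Each index [i] of the window contributes [r i * (r l + 2 * r i) <= 3 * r i ^+ 2 + r n ^+ 2],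
   using [r l <= r n]; there are at most [N] such indices. *)
pose q n := tmax * (1 + ctc) * (3 * S n + N%:R * r n ^+ 2).
have q_step n l : r l <= r n -> `|inner (x n.+1 - x n) (x l - xplus)| <= q n.
  move=> rln.
  rewrite (sesop_expansion x_sesop) addrAC subrr add0r linearNl normrN linear_sumlz.
  rewrite (le_trans (ler_norm_sum _ _ _))//.
  have term (i : 'I_n.+1) : i \in I n ->
      `|inner (t n i *: adjoint (F' (x i)) (w n i)) (x l - xplus)| <=
      tmax * (1 + ctc) * (3 * r i ^+ 2 + r n ^+ 2).
    move=> iI; rewrite innerZl adjointE; last exact: F'c.
    rewrite w_residual// normrM -mulrA; apply: ler_pM => //; first exact: t_bounded.
    rewrite (le_trans (norm_inner_le _ _))//.
    have := deriv_sub_solution_le _ _ _ _ F_tcc _ _ _ (Bx i) (Bx l) Bxplus ctc_ge0.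
    rewrite xplus_sol -/(r i) -/(r l) => h.
    have ri0 : 0 <= r i by exact: normr_ge0.
    have rl0 : 0 <= r l by exact: normr_ge0.
    rewrite (le_trans (ler_wpM2l ri0 h))// mulrCA ler_wpM2l ?addr_ge0//.
    have : r l ^+ 2 <= r n ^+ 2 by rewrite ler_pXn2r ?nnegrE// (le_trans rl0).
    have := sqr_ge0 (r i - r l); have := sqr_ge0 (r i); have := sqr_ge0 (r l).
    nra.
  rewrite (le_trans (ler_sum _ term))//.
  (* All terms are nonnegative, so [I n] may be enlarged to the full window. *)
  apply: (@le_trans _ _ (\sum_(i < n.+1 | (n < i + N)%N)
      tmax * (1 + ctc) * (3 * r i ^+ 2 + r n ^+ 2))).
    rewrite big_mkcond [leRHS]big_mkcond; apply: ler_sum => i _.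
    case: ifP => [/I_window -> //|_]; case: ifP => // _.
    by rewrite mulr_ge0// addr_ge0 ?sqr_ge0// mulr_ge0 ?sqr_ge0.
  rewrite -mulr_sumr ler_wpM2l// big_split/= -mulr_sumr lerD2l sumr_const.
  rewrite -[leLHS]mulr_natl ler_wpM2r ?sqr_ge0// ler_nat.
  apply: (@card_window_le _ (n.+1 - N)) => i ni.
  by have := ltn_ord i; lia.
(* The factor [4 * N] is [3 * N] from the window sums plus [N] from the terms [r n ^+ 2]. *)
have q_sum n : \sum_(i < n) q i <=
    tmax * (1 + ctc) * (4 * N%:R * (K * `|x 0%N - xplus| ^+ 2)).
  have -> : \sum_(i < n) q i =
      tmax * (1 + ctc) * (3 * (\sum_(i < n) S i) + N%:R * \sum_(i < n) r i ^+ 2).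
    by rewrite [3 * _]mulr_sumr [N%:R * _]mulr_sumr -big_split [RHS]mulr_sumr.
  rewrite ler_wpM2l//.
  have : \sum_(i < n) S i <= N%:R * \sum_(i < n) r i ^+ 2.
    exact: (@window_sum_le _ (fun i => r i ^+ 2) N n (fun i => sqr_ge0 (r i))).
  have := ler_wpM2l (ler0n R N) (r2_sum n).
  move: (\sum_(i < n) S i) (\sum_(i < n) _) => s1 s2; lra.
have /cvg_ex[l xl] : cvgn x.
  by apply: cvg_of_fejer (fun n => fejer1 n (fun i _ => Bx i)) q_step q_sum.
(* By [r_step] the residuals are dominated by the step lengths, which vanish since [x] converges. *)
have Fxy : F (x n) @[n --> \oo] --> y.
  apply/subr_cvg0/norm_cvg0P.
  apply: (@squeeze_cvgr _ _ _ _ (fun=> 0)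
    (fun n => cF / (1 - ctc) * `|x n.+1 - x n|)); last 2 first.
  - exact: cvg_cst.
  - rewrite -[X in _ --> X](mulr0 (cF / (1 - ctc))); apply: cvgMr.
    rewrite -(@normr0 _ X); apply: cvg_norm; rewrite -(subrr l).
    by apply: cvgB => //; rewrite (cvg_shiftS x).
  by apply: nearW => n; rewrite normr_ge0 r_step.
have [_ Fl] : D l /\ F l = y.
  apply: F_wsc Fxy => [n|u]; first exact: ball_sub_D.
  exact: continuous_cvg (inner_continuous u l) xl.
rewrite -(xplus_uniq l _ Fl)//.
by apply: (closed_cvg (closed_ball x0 rho)) xl => //; [exact: closed_ball_closed|exact: nearW].
Qed.
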